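(* Let $z_1,z_2,z_3$ be distinct complex numbers with $|z_1|=|z_2|=|z_3|=z_1z_2z_3=1$, and let $T'$ be the triangle with vertices $-z_1,-z_2,-z_3$ (the reflected triangle). For real $\theta$ let $\beta=e^{-2i\theta}$, $\gamma=e^{-2i\theta}+2e^{i\theta}$, $\gamma'=e^{-2i\theta}-2e^{i\theta}$, and let $N$ be the line segment connecting $\gamma$ and $\gamma'$ (whose midpoint is $\beta$). Then, with respect to $T'$, the point $\beta$ is on the circumcircle of $T'$, and the isogonal conjugate of $\beta$ is the point at infinity in the direction of $N$. Moreover, consider the line connecting $\beta$ to its isogonal conjugate (at infinity), i.e. the line through $\beta$ in the direction of that point at infinity. As $\theta$ varies over the real numbers, the envelope of the resulting family of lines is the standard deltoid.
   Context: The plane is identified with $\mathbb{C}$. The standard deltoid is $\Delta=\{2e^{i\varphi}+e^{-2i\varphi}:\varphi\in\mathbb{R}\}$, equivalently the set of $z$ with $z^2\bar z^2-4(z^3+\bar z^3)+18z\bar z-27=0$. The tangent line to $\Delta$ at $2e^{i\varphi}+e^{-2i\varphi}$ is the line through that point with direction $e^{-i\varphi/2}$; at the three cusps ($e^{3i\varphi}=1$) this is the limiting tangent line. Envelope: $\Delta$ is the envelope of a family of lines if every line of the family is tangent to $\Delta$ and every point of $\Delta$ is a point of tangency of some line of the family. Isogonal conjugate of a point $P$ on the circumcircle of a triangle: for each vertex $V$, reflect the line $VP$ about the interior angle bisector at $V$; the three reflected lines are parallel, and the isogonal conjugate of $P$ is their common point at infinity. If $P=V$, the line $VP$ is understood as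 the tangent to the circumcircle at $V$ and the same point at infinity is used. *)

(* Defs.v *)
From HB Require Import structures.
From mathcomp Require Import all_boot all_order all_algebra.
From mathcomp Require Import complex.
From mathcomp Require Import boolp classical_sets reals trigo.

Set Implicit Arguments.
Unset Strict Implicit.
Unset Printing Implicit Defensive.

Import Order.TTheory GRing.Theory Num.Theory.

Local Open Scope ring_scope.
Local Open Scope complex_scope.
Local Open Scope classical_set_scope.

Section Deltoid.
Variable R : realType.
Local Notation plane := R[i].

Implicit Types (p d o P U V W : plane) (L M : set plane) (t phi theta : R).

(* e^{it} *)
Definition expi t : plane := cos t +i* sin t.

(* A genuine line only when d != 0. *)
Definition line p d : set plane := [set z | exists t, z = p + t%:C * d].

(* Points at infinity of the plane are encoded as pencils of parallel lines:
   a line passes through the point at infinity Q exactly when it belongs to Q. *)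
Definition infinity_point d : set (set plane) :=
  [set L | exists p, L = line p d].

Definition is_infinity_point (Q : set (set plane)) : Prop :=
  exists2 d, d != 0 & Q = infinity_point d.

Definition deltoid_point phi : plane := 2 * expi phi + expi (- (2 * phi)).

Definition deltoid : set plane := [set z | exists phi, z = deltoid_point phi].

Definition deltoid_tangent phi : set plane :=
  line (deltoid_point phi) (expi (- (phi / 2))).

(* phi is determined by p modulo 2 pi, and adding 2 pi to phi only changes the
   sign of the direction, so the tangent line at p is unique. *)
Definition tangent_to_deltoid_at L p : Prop :=
  exists2 phi, p = deltoid_point phi & L = deltoid_tangent phi.

Definition deltoid_is_envelope (F : set (set plane)) : Prop :=
  (forall L, F L -> exists2 p, deltoid p & tangent_to_deltoid_at L p) /\
  (forall p, deltoid p -> exists2 L, F L & tangent_to_deltoid_at L p).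

Definition is_circumcenter U V W o : Prop :=
  `|U - o| = `|V - o| /\ `|V - o| = `|W - o|.

Definition circumcircle U V W : set plane :=
  [set P | exists2 o, is_circumcenter U V W o & `|P - o| = `|U - o|].

(* Reflection about line p d, for d != 0. *)
Definition reflection p d (z : plane) : plane := p + d * ((z - p) / d)^*.

(* Direction of the interior bisector of the angle U V W: the sum of the unit
   vectors from V towards U and W. *)
Definition bisector_dir U V W : plane :=
  (U - V) / `|U - V| + (W - V) / `|W - V|.

(* The line VP, read as the tangent at V to the circle centred at o if P = V. *)
Definition vertex_line o V P : set plane :=
  if P == V then line V ('i%C * (V - o)) else line V (P - V).

(* The line VP reflected about the interior bisector of the angle U V W. *)
Definition reflected_vertex_line o U V W P : set plane :=
  reflection V (bisector_dir U V W) @` vertex_line o V P.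

(* Q is the isogonal conjugate, with respect to the triangle U V W, of the point
   P of its circumcircle. *)
Definition is_isogonal_conjugate U V W P (Q : set (set plane)) : Prop :=
  is_infinity_point Q /\
  exists o,
    [/\ is_circumcenter U V W o,
        Q (reflected_vertex_line o W U V P),
        Q (reflected_vertex_line o U V W P) &
        Q (reflected_vertex_line o V W U P)].

(* The lines joining P theta to its isogonal conjugate, theta ranging over R. *)
Definition isogonal_line_family U V W (P : R -> plane) : set (set plane) :=
  [set L | exists theta, exists Q : set (set plane),
     [/\ is_isogonal_conjugate U V W (P theta) Q, Q L & L (P theta)]].

Definition beta theta : plane := expi (- (2 * theta)).
Definition gamma theta : plane := expi (- (2 * theta)) + 2 * expi theta.
Definition gamma' theta : plane := expi (- (2 * theta)) - 2 * expi theta.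

End Deltoid.

(* Main.v *)
Require Import Defs.
From HB Require Import structures.
From mathcomp Require Import all_boot all_order all_algebra ring.
From mathcomp Require Import complex.
From mathcomp Require Import boolp classical_sets reals trigo.

Import Order.TTheory GRing.Theory Num.Theory.

Local Open Scope ring_scope.
Local Open Scope complex_scope.
Local Open Scope classical_set_scope.

(** Write [slope d = d / d^*], the square of the unit vector along [d]. It is
    multiplicative in [d], equals 1 on nonzero reals, and hence determines the
    nonzero direction [d] exactly up to a real factor: it is the invariant of the
    point at infinity of a line. On the unit circle every direction that occurs
    has a slope that is a monomial: the chord from [U] to [V] has slope [- U V],
    the tangent at [U] has slope [- U ^ 2] (the value of the chord formula at
    [V = U], so one formula covers the tangent convention), and the bisector of
    two unit directions [u], [v] has slope [u v]. Reflecting a direction [e]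
    about [d] gives slope
    [slope d ^ 2 / slope e]; at the vertex [V] of the triangle [U V W], with
    [e] the direction of [V P], this is
    [(- U V) (- W V) / (- P V) = - U V W / P], which is symmetric in the three
    vertices ([reflected_vertex_lineE]). So the three reflected lines are
    parallel, and their direction determines the isogonal conjugate of [P]
    ([isogonal_conjugateP]).

    For the reflected triangle the product of the vertices is [-1], so the slope
    is [1 / beta = e^{2 i theta}], the slope of [e^{i theta}] and of the segment
    from [gamma] to [gamma']. The line of the family with parameter [theta] is
    therefore the line through [beta theta] with direction [e^{i theta}]. It is
    the tangent to the deltoid with parameter [- 2 theta], because the two base
    points differ by [2 cos (3 theta) e^{i theta}] ([beta_lineE]). Since
    [theta |-> - 2 theta] is onto, the family consists of all tangents. *)

(** * Slopes of directions *)

Definition slope {R : realType} (d : R[i]) : R[i] := d / d^*%R.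

Section Slopes.
Variable R : realType.
Implicit Types (d e u v U V p q : R[i]) (r : R).

Lemma slopeM d e : slope (d * e) = slope d * slope e.
Proof. by rewrite /slope rmorphM/= invfM mulrACA. Qed.

Lemma slopeV d : slope d^-1 = (slope d)^-1.
Proof. by rewrite /slope fmorphV invf_div invrK mulrC. Qed.

Lemma slope_conj d : slope d^*%R = (slope d)^-1.
Proof. by rewrite /slope conjCK invf_div. Qed.

Lemma slope_neq0 d : d != 0 -> slope d != 0.
Proof. by move=> d0; rewrite mulf_neq0 ?invr_neq0 ?conjC_eq0. Qed.

Lemma slope_real d : d \is Num.real -> d != 0 -> slope d = 1.
Proof. by move=> /CrealP dE d0; rewrite /slope dE divff. Qed.

Lemma slope_scale r d : r != 0 -> slope (r%:C * d) = slope d.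
Proof.
move=> r0; rewrite slopeM slope_real ?mul1r//; first by rewrite complex_real.
by rewrite fmorph_eq0.
Qed.

Lemma conj_unit u : `|u| = 1 -> u^*%R = u^-1.
Proof. by move=> u1; rewrite invC_norm u1 expr1n invr1 mul1r. Qed.

Lemma unit_neq0 u : `|u| = 1 -> u != 0.
Proof. by move=> u1; rewrite -normr_eq0 u1 oner_eq0. Qed.

Lemma slope_unit u : `|u| = 1 -> slope u = u ^+ 2.
Proof. by move=> u1; rewrite /slope conj_unit// invrK. Qed.

Lemma slope_normalize d : d != 0 -> slope (d / `|d|) = slope d.
Proof.
move=> d0; rewrite slopeM slopeV (slope_real `|d|) ?normr_real ?normr_eq0//.
by rewrite invr1 mulr1.
Qed.

Lemma norm_normalize d : d != 0 -> `|d / `|d| | = 1.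
Proof. by move=> d0; rewrite normf_div normr_id divff ?normr_eq0. Qed.

(** The sum of two unit vectors bisects their angle. *)
Lemma slope_add_unit u v :
  `|u| = 1 -> `|v| = 1 -> u + v != 0 -> slope (u + v) = u * v.
Proof.
move=> u1 v1 uv0; have [u0 v0] := (unit_neq0 _ u1, unit_neq0 _ v1).
rewrite /slope rmorphD/= !conj_unit//.
have -> : u^-1 + v^-1 = (u + v) / (u * v) by field; rewrite u0 v0.
by rewrite invf_div mulrCA divff// mulr1.
Qed.

Lemma slope_chord U V :
  `|U| = 1 -> `|V| = 1 -> U != V -> slope (U - V) = - (U * V).
Proof.
move=> U1 V1; rewrite -subr_eq0 => UV.
by rewrite slope_add_unit ?normrN// mulrN.
Qed.

Lemma norm_i : `|'i%C : R[i]| = 1.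
Proof. by apply/eqP; rewrite -(@pexpr_eq1 _ _ 2)// -normrX sqr_i normrN1. Qed.

Lemma slope_tangent U : `|U| = 1 -> slope ('i%C * U) = - (U * U).
Proof.
by move=> U1; rewrite slopeM !slope_unit ?norm_i// sqr_i mulN1r.
Qed.

(** * Lines and points at infinity *)

(** The quotient of two directions of equal slope is its own conjugate. *)
Lemma slope_inj d e : d != 0 -> e != 0 -> slope d = slope e ->
  exists2 r, r != 0 & d = r%:C * e.
Proof.
move=> d0 e0 de.
have /CrealP/complex_realP[r rE] : (d / e)^*%R = d / e.
  rewrite fmorph_div; apply/(mulIf (slope_neq0 _ d0)).
  rewrite {2}de /slope; field.
  by rewrite e0 !conjC_eq0 d0 e0.
have dE : d = r%:C * e by rewrite -rE divfK.
exists r => //; apply: contraNneq d0 => r0.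
by rewrite dE r0 mul0r.
Qed.

Lemma line_scale p d r : r != 0 -> line p (r%:C * d) = line p d.
Proof.
move=> r0; apply/seteqP; split=> z [t ->].
  by exists (t * r); rewrite rmorphM/= mulrA.
by exists (t / r); rewrite mulrA -rmorphM/= divfK.
Qed.

Lemma line_shift p d r : line (p + r%:C * d) d = line p d.
Proof.
apply/seteqP; split=> z [t ->].
  by exists (r + t); rewrite rmorphD/= mulrDl addrA.
by exists (t - r); rewrite rmorphB/=; ring.
Qed.

Lemma line_base p d : line p d p.
Proof. by exists 0; rewrite mul0r addr0. Qed.

Lemma line_rebase p q d : line p d q -> line p d = line q d.
Proof. by case=> t ->; rewrite line_shift. Qed.

Lemma eq_slope_line p d e : d != 0 -> e != 0 -> slope d = slope e ->
  line p d = line p e.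
Proof. by move=> d0 e0 /(slope_inj _ _ d0 e0)[r r0 ->]; rewrite line_scale. Qed.

Lemma eq_slope_infinity_point d e : d != 0 -> e != 0 -> slope d = slope e ->
  infinity_point d = infinity_point e.
Proof.
move=> d0 e0 de; apply/seteqP; split=> L [p ->]; exists p.
  exact: eq_slope_line.
by apply: eq_slope_line.
Qed.

Lemma line_eq_slope p q d e : d != 0 -> line p d = line q e -> slope d = slope e.
Proof.
move=> d0 pq; have [s ps] : line q e p by rewrite -pq; exact: line_base.
have [t pt] : line q e (p + d).
  by rewrite -pq; exists 1; rewrite mul1r.
have dE : d = (t - s)%:C * e.
  by rewrite -[LHS](addKr p) pt ps rmorphB/=; ring.
rewrite dE slope_scale//; apply: contraNneq d0 => ts.
by rewrite dE ts mul0r.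
Qed.

Lemma infinity_point_slope d e p : d != 0 -> e != 0 ->
  infinity_point d (line p e) -> infinity_point d = infinity_point e.
Proof.
move=> d0 e0 [q pq]; apply: eq_slope_infinity_point => //.
by rewrite (line_eq_slope _ _ _ _ e0 pq).
Qed.

Lemma reflection_line p d e :
  reflection p d @` line p e = line p (d * (e / d)^*%R).
Proof.
have refE t : reflection p d (p + t%:C * e) = p + t%:C * (d * (e / d)^*%R).
  rewrite /reflection addrAC subrr add0r -mulrA rmorphM/= conj_Creal.
    by rewrite mulrCA.
  by rewrite complex_real.
apply/seteqP; split=> [_ [_ [t ->] <-]|_ [t ->]]; first by exists t.
by exists (p + t%:C * e); [exists t|].
Qed.

Lemma slope_reflection d e : slope (d * (e / d)^*%R) = slope d ^+ 2 / slope e.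
Proof.
by rewrite slopeM slope_conj slopeM slopeV invfM invrK mulrCA mulrC expr2.
Qed.

End Slopes.

(** * Isogonal conjugates on the unit circle *)

Section Isogonal.
Variable R : realType.
Implicit Types (U V W P o d : R[i]) (Q : set (set R[i])).

Lemma bisector_dir_slope U V W : `|U| = 1 -> `|V| = 1 -> `|W| = 1 ->
  U != V -> W != V -> U != W ->
  bisector_dir U V W != 0 /\
  slope (bisector_dir U V W) ^+ 2 = U * W * V ^+ 2.
Proof.
move=> U1 V1 W1 UV WV UW; rewrite /bisector_dir.
have UV0 : U - V != 0 by rewrite subr_eq0.
have WV0 : W - V != 0 by rewrite subr_eq0.
set u := (U - V) / _; set v := (W - V) / _.
have u1 : `|u| = 1 by exact: norm_normalize.
have v1 : `|v| = 1 by exact: norm_normalize.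
have uE : u ^+ 2 = - (U * V).
  by rewrite -slope_unit// slope_normalize// slope_chord.
have vE : v ^+ 2 = - (W * V).
  by rewrite -slope_unit// slope_normalize// slope_chord.
have uv0 : u + v != 0.
  (* Opposite directions have equal slopes, so U V = W V. *)
  apply: contraNneq UW => /eqP; rewrite addr_eq0 => /eqP uv.
  apply/eqP/(mulIf (unit_neq0 _ _ V1))/oppr_inj.
  by rewrite -uE -vE uv sqrrN.
split=> //; rewrite slope_add_unit// exprMn uE vE; ring.
Qed.

(** The direction of the reflected line is symmetric in the three vertices,
    which is why the three reflected lines are parallel. *)
Lemma reflected_vertex_lineE o U V W P :
  `|U| = 1 -> `|V| = 1 -> `|W| = 1 -> `|P| = 1 ->
  U != V -> W != V -> U != W -> (P = V -> o = 0) ->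
  exists e, [/\ e != 0, slope e = - (U * V * W) / P &
                reflected_vertex_line o U V W P = line V e].
Proof.
move=> U1 V1 W1 P1 UV WV UW oP.
have [b0 bE] := bisector_dir_slope _ _ _ U1 V1 W1 UV WV UW.
have [V0 P0] := (unit_neq0 _ _ V1, unit_neq0 _ _ P1).
have [e [e0 eE vE]] : exists e, [/\ e != 0, slope e = - (P * V) &
    vertex_line o V P = line V e].
  rewrite /vertex_line; case: eqP => [PV|/eqP PV].
    exists ('i%C * V); split.
    - by rewrite mulf_neq0// unit_neq0// norm_i.
    - by rewrite slope_tangent// PV.
    - by rewrite oP// subr0.
  by exists (P - V); split; rewrite ?subr_eq0// slope_chord.
rewrite /reflected_vertex_line vE reflection_line.
eexists; split; last reflexivity.
  by rewrite mulf_neq0// conjC_eq0 mulf_neq0// invr_neq0.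
rewrite slope_reflection bE eE; field.
by rewrite V0 P0.
Qed.

(** The circle being centred at 0, the tangent convention applies with [o = 0];
    an arbitrary witness [o] of the definition is handled by choosing a vertex
    distinct from [P], where the chord itself gives the direction. *)
Lemma isogonal_conjugateP U V W P d Q :
  `|U| = 1 -> `|V| = 1 -> `|W| = 1 -> `|P| = 1 ->
  U != V -> U != W -> V != W -> d != 0 -> slope d = - (U * V * W) / P ->
  is_isogonal_conjugate U V W P Q <-> Q = infinity_point d.
Proof.
move=> U1 V1 W1 P1 UV UW VW d0 dE.
have [VU WU WV] : [/\ V != U, W != U & W != V].
  by rewrite ![_ == U]eq_sym [W == V]eq_sym.
have lineU o : (P = U -> o = 0) -> exists e, [/\ e != 0, slope e = slope d &
    reflected_vertex_line o W U V P = line U e].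
  move=> /(reflected_vertex_lineE _ _ _ _ _ W1 U1 V1 P1 WU VU WV)[e [e0 eE ->]].
  by exists e; split=> //; rewrite eE dE -(mulrA W) [W * _]mulrC.
have lineV o : (P = V -> o = 0) -> exists e, [/\ e != 0, slope e = slope d &
    reflected_vertex_line o U V W P = line V e].
  move=> /(reflected_vertex_lineE _ _ _ _ _ U1 V1 W1 P1 UV WV UW)[e [e0 eE ->]].
  by exists e; split=> //; rewrite eE dE.
have lineW o : (P = W -> o = 0) -> exists e, [/\ e != 0, slope e = slope d &
    reflected_vertex_line o V W U P = line W e].
  move=> /(reflected_vertex_lineE _ _ _ _ _ V1 W1 U1 P1 VW UW VU)[e [e0 eE ->]].
  by exists e; split=> //; rewrite eE dE [V * W * U]mulrC mulrA.
split=> [[[d' d'0 ->] [o [_ QU QV _]]]|->].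
  (* One reflected line already fixes the point at infinity: use the one at V
     if P = U, and the one at U otherwise. *)
  have [p [e [e0 eE Qe]]] : exists p e,
      [/\ e != 0, slope e = slope d & infinity_point d' (line p e)].
    have [PU|/eqP PU] := eqVneq P U.
      have oV : P = V -> o = 0 by move=> PV; rewrite -PU PV eqxx in UV.
      have [e [e0 eE le]] := lineV o oV.
      by exists V, e; rewrite -le.
    have oU : P = U -> o = 0 by [].
    have [e [e0 eE le]] := lineU o oU.
    by exists U, e; rewrite -le.
  rewrite (infinity_point_slope _ _ _ _ d'0 e0 Qe).
  exact: eq_slope_infinity_point.
split; first by exists d.
have mem (L : set R[i]) p :
    (exists e, [/\ e != 0, slope e = slope d & L = line p e]) ->
    infinity_point d L.
  move=> [e [e0 eE ->]]; exists p; exact: eq_slope_line.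
exists 0; split; first by rewrite /is_circumcenter !subr0 U1 V1 W1.
- by apply: mem; exact: lineU.
- by apply: mem; exact: lineV.
- by apply: mem; exact: lineW.
Qed.

End Isogonal.

(** * The deltoid *)

Section Expi.
Variable R : realType.
Implicit Types s t theta : R.

Lemma expiD s t : expi (s + t) = expi s * expi t.
Proof.
rewrite /expi cosD sinD; simpc.
by congr (_ +i* _); rewrite [RHS]addrC [sin s * _]mulrC.
Qed.

Lemma norm_expi t : `|expi t| = 1.
Proof. by rewrite normc_def/= cos2Dsin2 sqrtr1. Qed.

Lemma expi_neq0 t : expi t != 0.
Proof. by apply: unit_neq0; exact: norm_expi. Qed.

Lemma expiN t : expi (- t) = (expi t)^-1.
Proof. by rewrite -conj_unit ?norm_expi// /expi cosN sinN. Qed.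

Lemma expiDconj t : expi t + expi (- t) = (2 * cos t)%:C.
Proof. by rewrite /expi cosN sinN; simpc; congr (_ +i* _); ring. Qed.

(** The point of tangency [2 e^{-2 i theta} + e^{4 i theta}] minus
    [beta theta] is [2 cos (3 theta) e^{i theta}], a real multiple of the common
    direction. *)
Lemma beta_lineE theta :
  line (beta theta) (expi theta) = deltoid_tangent (- (2 * theta)).
Proof.
rewrite /deltoid_tangent.
have -> : - (- (2 * theta) / 2) = theta by field.
rewrite -(@line_shift _ (beta theta) _ (2 * cos (3 * theta))) -expiDconj.
congr line; rewrite /beta /deltoid_point (mulrDl (expi _)) -!expiD.
have -> : 3 * theta + theta = - (2 * - (2 * theta)) by ring.
have -> : - (3 * theta) + theta = - (2 * theta) by ring.
ring.
Qed.

End Expi.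

Theorem theorem2p2 (R : realType) (z1 z2 z3 : R[i])
  (h12 : z1 != z2) (h13 : z1 != z3) (h23 : z2 != z3)
  (hz1 : `|z1| = 1) (hz2 : `|z2| = 1) (hz3 : `|z3| = 1)
  (hz : z1 * z2 * z3 = 1) :
  (forall theta : R,
     [/\ beta theta = (gamma theta + gamma' theta) / 2,
         circumcircle (- z1) (- z2) (- z3) (beta theta) &
         forall Q : set (set R[i]),
           is_isogonal_conjugate (- z1) (- z2) (- z3) (beta theta) Q <->
           Q = infinity_point (gamma' theta - gamma theta)]) /\
  deltoid_is_envelope
    (isogonal_line_family (- z1) (- z2) (- z3) (@beta R)).
Proof.
have slopeE theta :
    slope (expi theta) = - (- z1 * - z2 * - z3) / beta theta.
  rewrite slope_unit ?norm_expi// mulrNN mulrN opprK hz div1r /beta expiN invrK.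
  by rewrite expr2 -expiD mulr_natl.
have conjP theta Q :
    is_isogonal_conjugate (- z1) (- z2) (- z3) (beta theta) Q <->
    Q = infinity_point (expi theta).
  apply: isogonal_conjugateP; rewrite ?normrN ?norm_expi ?eqr_opp//.
  exact: expi_neq0.
have segE theta : gamma' theta - gamma theta = (- 4)%:C * expi theta.
  rewrite /gamma /gamma' rmorphN rmorph_nat; ring.
have familyP L : isogonal_line_family (- z1) (- z2) (- z3) (@beta R) L <->
    exists theta, L = deltoid_tangent (- (2 * theta)).
  split=> [[theta [Q [/conjP -> [p ->] /line_rebase ->]]]|[theta ->]].
    by exists theta; rewrite beta_lineE.
  exists theta, (infinity_point (expi theta)); rewrite -beta_lineE.
  by split; [exact/conjP|exists (beta theta)|exact: line_base].
split=> [theta|].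
  split.
  - by rewrite /gamma /gamma' /beta; field.
  - exists 0; first by rewrite /is_circumcenter !subr0 !normrN hz1 hz2 hz3.
    by rewrite !subr0 normrN hz1 norm_expi.
  - move=> Q; rewrite segE conjP.
    suff -> : infinity_point ((- 4)%:C * expi theta) =
              infinity_point (expi theta) by [].
    have n4 : (- 4 : R) != 0 by rewrite oppr_eq0 pnatr_eq0.
    apply: eq_slope_infinity_point; rewrite ?slope_scale ?expi_neq0//.
    by rewrite mulf_neq0 ?expi_neq0// fmorph_eq0.
split=> [L /familyP[theta ->]|p [phi ->]].
  by exists (deltoid_point (- (2 * theta))); exists (- (2 * theta)).
exists (deltoid_tangent phi); last by exists phi.
by apply/familyP; exists (- (phi / 2)); congr deltoid_tangent; field.
Qed.
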